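(* For every infinite word $w$ over a finite alphabet and for every positive integer $n$, $$L_w(n)+L_w(n+1) \leq C_w(n)-C_w(n-1)+1+|\mathrm{Alph}(w)|+p(n+1),$$ where $L_w(k)$ is the value of the Lie complexity function of $w$ at $k$, $C_w(k)$ is the number of length-$k$ factors of $w$, $|\mathrm{Alph}(w)|$ is the cardinality of the alphabet of $w$, and $p(k)$ is the cardinality of the set $\{[u] : [u]\subset \mathrm{Fac}(w),\ |u|=k,\ u \text{ is primitive}\}$.
   Context: A factor of $w$ is a finite block of contiguous letters of $w$ (the empty word is a factor, so $C_w(0)=1$). $\mathrm{Fac}(w)$ is the set of all factors of $w$. $\mathrm{Alph}(w)$ is the set of letters occurring in $w$. Two finite words $u,v$ are conjugate if $u=xy$ and $v=yx$ for some words $x,y$; $[u]$ denotes the conjugacy class of $u$. A finite word is primitive if it is not a power $v^k$ ($k$ a natural number) of another word $v$. The Lie complexity function is defined, for positive $n$, by $L_w(n)=|\{[u] : [u]\subset\mathrm{Fac}(w),\ |u|=n\}|$, the number of conjugacy classes of length-$n$ words all of whose elements are factors of $w$. *)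

(* Defs.v *)
(* Plain MathComp, plus mathcomp.classical.boolp for [`[< P >]] : bool, the
   truth value of P : Prop. *)
From mathcomp Require Import all_boot all_order all_algebra.
From mathcomp Require Import boolp.

Set Implicit Arguments.
Unset Strict Implicit.
Unset Printing Implicit Defensive.

(* Finite words over A are [seq A]; infinite words are functions nat -> A. *)

Definition factor (A : Type) (w : nat -> A) (u : seq A) : Prop :=
  exists i : nat, u = [seq w j | j <- iota i (size u)].

Definition conjugate (A : Type) (u v : seq A) : Prop :=
  exists x y : seq A, u = x ++ y /\ v = y ++ x.

Definition word_power (A : Type) (v : seq A) (k : nat) : seq A :=
  flatten (nseq k v).

Definition primitive (A : Type) (u : seq A) : Prop :=
  ~ exists (v : seq A) (k : nat), v <> u /\ u = word_power v k.

Definition Alph (A : finType) (w : nat -> A) : {set A} :=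
  [set a | `[< exists i : nat, w i = a >]].

(* Fac(w) restricted to the words of length n. *)
Definition Fac (A : finType) (w : nat -> A) (n : nat) : {set n.-tuple A} :=
  [set u : n.-tuple A | `[< factor w u >]].

Definition factor_complexity (A : finType) (w : nat -> A) (n : nat) : nat :=
  #|Fac w n|.

(* Conjugate words have the same length, so the whole class of u lies in
   [n.-tuple A], and it is contained in Fac(w) iff it is contained in
   [Fac w n]. *)
Definition conj_class (A : finType) (n : nat) (u : n.-tuple A) :
    {set n.-tuple A} :=
  [set v : n.-tuple A | `[< conjugate u v >]].

Definition Lie_complexity (A : finType) (w : nat -> A) (n : nat) : nat :=
  #|[set conj_class u | u : n.-tuple A & conj_class u \subset Fac w n]|.

Definition primitive_Lie_complexity (A : finType) (w : nat -> A) (n : nat) :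
    nat :=
  #|[set conj_class u | u : n.-tuple A &
       (conj_class u \subset Fac w n) && `[< primitive u >]]|.

(* Main.v *)
Require Import Defs.
From mathcomp Require Import all_boot all_order all_algebra.
From mathcomp Require Import boolp zify.
Import Order.TTheory GRing.Theory Num.Theory.
Local Open Scope ring_scope.

(** The inequality compares the rank of the cycle space of a Rauzy graph with
    the number of independent cycles produced by conjugacy classes.

    Let G be the graph whose vertices are the factors of w of length n - 1 and
    whose edges are the factors of length n, the edge e leading from its prefix
    to its suffix of length n - 1.  Reading w from left to right is a walk in G
    that meets every vertex, so G is connected and its cycle space has
    dimension C(n) - C(n-1) + 1, which bounds the number of independent
    circulations ([cycle_space_bound], [walk_const]).

    A class of words contained in Fac(w), of length n or n + 1, gives a closed
    walk in G: each rotation y of the cyclic word traverses the edge spelled by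
    its first n letters, and rotating y by one letter moves to the next edge
    ([traversals_circulation]).  For length n, distinct classes use disjoint
    sets of edges.  For length n + 1 this can fail, but it holds among the
    nonconstant powers v^k with k >= 2: such a word is determined by its first
    n letters ([power_classes_init_inj]).  Finally the two kinds of cycles are
    jointly independent.  If a relation involved the class T of a nonconstant
    power, each edge of T would lie in a class of length n also occurring in
    the relation, and the edges of the latter would again lie in classes of
    nonconstant powers; but from some edge of T, rotating it as a word of
    length n leads to a word that is not the prefix of any power in the
    classes considered ([power_class_exit], [cycle_independence]).  Both facts on
    powers are instances of one periodicity statement in the spirit of Fine and
    Wilf, [agree_off_two].

    Hence L(n) plus the number of classes of nonconstant powers of length n + 1
    is at most C(n) - C(n-1) + 1.  The remaining classes of length n + 1 are
    primitive, counted by p(n+1), or consist of a single word a^(n+1), and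
    there are at most |Alph(w)| of those ([Lie_complexity_split]). *)

(** * Circulations in a finite connected graph *)

(** In a directed multigraph with edges [FE] and vertices [FV], where [s] and
    [t] give the ends of an edge, the circulations [C i] are the rows of a
    matrix annihilated by the incidence matrix.  Connectedness, expressed by
    potentials, says that the kernel of the transposed incidence matrix is at
    most a line, so the incidence matrix has rank at least [#|FV| - 1]. *)
Lemma cycle_space_bound {E V I : finType} {FE : {set E}} {FV : {set V}}
    {s t : E -> V} {C : I -> E -> rat} :
  (forall e, e \in FE -> s e \in FV /\ t e \in FV) ->
  (forall f : V -> rat, (forall e, e \in FE -> f (s e) = f (t e)) ->
     {in FV &, forall u v, f u = f v}) ->
  (forall i v, \sum_(e in FE) C i e * ((t e == v)%:R - (s e == v)%:R) = 0) ->
  (forall x : I -> rat, (forall e, e \in FE -> \sum_i x i * C i e = 0) ->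
     forall i, x i = 0) ->
  (#|I| + #|FV| <= #|FE| + 1)%N.
Proof.
move=> st_FV conn circ free.
pose M : 'M[rat]_(#|I|, #|FE|) := \matrix_(i, e) C (enum_val i) (enum_val e).
pose D : 'M[rat]_(#|FE|, #|FV|) :=
  \matrix_(e, v) ((t (enum_val e) == enum_val v)%:R
                  - (s (enum_val e) == enum_val v)%:R).
have MD0 : M *m D = 0.
  apply/matrixP=> i v; rewrite !mxE -[RHS](circ (enum_val i) (enum_val v)).
  rewrite [RHS]big_enum_val /=.
  by apply: eq_bigr => e _; rewrite !mxE.
have rkM : \rank M = #|I|.
  apply/eqP; rewrite -/(row_free M) -kermx_eq0; apply/eqP/row_matrixP => j.
  rewrite row0; set x := row j _.
  have /rowP xM0 : x *m M = 0 by apply/sub_kermxP; apply: row_sub.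
  apply/rowP => i; rewrite [RHS]mxE -(enum_valK i).
  move: (enum_val i); apply: (free (fun j => x 0 (enum_rank j))) => e eFE.
  have := xM0 (enum_rank_in eFE e); rewrite !mxE => xe.
  rewrite -[RHS]xe [RHS](reindex_onto enum_rank enum_val) /=; last first.
    by move=> k _; rewrite enum_valK.
  apply: eq_big => [k|k _]; first by rewrite enum_rankK eqxx.
  by rewrite !mxE enum_rankK enum_rankK_in.
have rkK : (\rank (kermx D^T) <= 1)%N.
  apply: leq_trans (rank_leq_row (const_mx 1 : 'rV[rat]_#|FV|)).
  apply/mxrankS/rV_subP => u /sub_kermxP uD0.
  have [v0 _|FV0] := pickP 'I_#|FV|; last first.
    by rewrite (_ : u = 0) ?sub0mx //; apply/rowP => v; have := FV0 v.
  suff -> : u = u 0 v0 *: const_mx 1 by apply: scalemx_sub.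
  apply/rowP => v; rewrite !mxE mulr1.
  pose f y := u 0 (enum_rank_in (enum_valP v0) y).
  have fE k : u 0 k = f (enum_val k) by rewrite /f enum_valK_in.
  rewrite !fE; apply: conn (enum_valP _) (enum_valP _) => e eFE.
  have := congr1 (fun B : 'rV_#|FE| => B 0 (enum_rank_in eFE e)) uD0.
  rewrite !mxE; under eq_bigr => k _.
    rewrite !mxE enum_rankK_in // fE mulrBr; over.
  rewrite sumrB.
  have pick y : y \in FV ->
      \sum_(k < #|FV|) f (enum_val k) * (y == enum_val k)%:R = f y.
    move=> yFV; rewrite -(big_enum_val (fun z => f z * (y == z)%:R)) /=.
    rewrite (bigD1 y) //= eqxx mulr1 big1 ?addr0 // => z /andP[_ zy].
    by rewrite eq_sym (negPf zy) mulr0.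
  have [sV tV] := st_FV e eFE.
  by rewrite !pick // => /eqP; rewrite subr_eq0 => /eqP.
have := mulmx0_rank_max MD0; rewrite rkM.
by move: rkK; rewrite mxrank_ker mxrank_tr; have := rank_leq_col D; lia.
Qed.

(** When [S] indexes the steps of closed walks and [p] gives the edge traversed
    at each step, this is the flow carried by the walks through [e]. *)
Definition traversals {Y E : finType} (p : Y -> E) (S : {set Y}) (e : E) :
    rat :=
  \sum_(y in S) (p y == e)%:R.

Lemma traversals_neq0P {Y E : finType} {p : Y -> E} {S : {set Y}} {e : E} :
  reflect (exists2 y, y \in S & p y = e) (traversals p S e != 0).
Proof.
rewrite /traversals -natr_sum pnatr_eq0 sum_nat_eq0 negb_forall.
apply: (iffP existsP) => [[y]|[y yS py]]; last first.
  by exists y; rewrite yS py eqxx.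
by rewrite negb_imply eqb0 negbK => /andP[yS /eqP py]; exists y.
Qed.

(** The successor [r] permutes the steps, so every arrival at [v] is matched
    with the departure from [v] at the next step. *)
Lemma traversals_circulation {Y E V : finType} {FE : {set E}} {s t : E -> V}
    {p : Y -> E} {r : Y -> Y} {S : {set Y}} (v : V) :
  injective r -> {in S, forall y, r y \in S} ->
  (forall y, t (p y) = s (p (r y))) -> {in S, forall y, p y \in FE} ->
  \sum_(e in FE) traversals p S e * ((t e == v)%:R - (s e == v)%:R) = 0.
Proof.
move=> r_inj rS tps pFE; pose g e : rat := (t e == v)%:R - (s e == v)%:R.
under eq_bigr do rewrite mulr_suml.
rewrite exchange_big /= (eq_bigr (fun y => g (p y))) => [|y yS]; last first.
  rewrite (bigD1 (p y)) ?pFE //= eqxx mul1r big1 ?addr0 // => e /andP[_ ne].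
  by rewrite eq_sym (negPf ne) mul0r.
have rSS : r @: S = S.
  apply/eqP; rewrite eqEcard card_imset // leqnn andbT.
  by apply/subsetP => _ /imsetP[y yS ->]; apply: rS.
rewrite sumrB -[X in _ - X]/(\sum_(y in S) (s (p y) == v)%:R).
rewrite -{2}rSS big_imset /=; last by move=> x y _ _; apply: r_inj.
by under eq_bigr do rewrite tps; rewrite subrr.
Qed.

(** * Periodic words *)

(** Modulo N, the two functions are only known to agree away from [L] and
    [L + 1].  From [L] one can reach a common value by shifts that avoid both
    exceptional positions: [+p] preserves [f], [-q] preserves [g], and the
    order of the shifts can be exchanged because [p - q] is neither [0] nor [1]
    modulo N when [1 < p < q < N]. *)
Lemma agree_off_two {A : Type} {f g : nat -> A} {N p q L : nat} :
  (p %| N)%N -> (q %| N)%N -> (1 < p < N)%N -> (1 < q < N)%N ->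
  (forall i, f (i + p)%N = f i) -> (forall i, g (i + q)%N = g i) ->
  (forall i, (1 < i < N)%N -> f (L + i)%N = g (L + i)%N) ->
  f L = g L.
Proof.
wlog lepq : f g p q / (p <= q)%N => [hw|].
  case: (leqP p q) => [|/ltnW] h pN qN p1 q1 fp gq fg.
    exact: (hw f g p q).
  by symmetry; apply: (hw g f q p) => // i /fg.
move=> pN qN p1 q1 fp gq fg.
case: (ltngtP p q) lepq => // [ltpq _|eqpq _]; last first.
  by rewrite -fp fg // eqpq gq.
have per (h : nat -> A) d : (forall i, h (i + d)%N = h i) ->
    forall k i, h (i + k * d)%N = h i.
  by move=> hd; elim=> [|k IH] i; rewrite ?addn0 // mulSn addnA IH hd.
case/dvdnP: (qN) => k Nk.
have q2 : (q.*2 <= N)%N.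
  by move: Nk q1; clear; case: k => [|[|k]]; rewrite ?mulSn; lia.
(* Subtracting q is adding N - q, which is also a multiple of q. *)
have gNq i : g (i + (N - q))%N = g i.
  by rewrite Nk -{2}[q]mul1n -mulnBl per.
rewrite -fp fg // -gNq -addnA -fg; last by lia.
rewrite [(p + _)%N]addnC addnA fp fg ?gNq //; lia.
Qed.

Definition cyclic_letter {A : Type} (x0 : A) (u : seq A) (i : nat) : A :=
  nth x0 u (i %% size u).

Lemma cyclic_letter_lt {A : Type} (x0 : A) {u : seq A} {i : nat} :
  (i < size u)%N -> cyclic_letter x0 u i = nth x0 u i.
Proof. by move=> iu; rewrite /cyclic_letter modn_small. Qed.

Lemma cyclic_letter_rot {A : Type} (x0 : A) (u : seq A) (k i : nat) :
  (k <= size u)%N -> cyclic_letter x0 (rot k u) i = cyclic_letter x0 u (i + k).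
Proof.
have [/size0nil -> _|u_gt0 ku] := posnP (size u).
  by rewrite /cyclic_letter !nth_nil.
rewrite /cyclic_letter size_rot /rot nth_cat size_drop nth_drop.
have im := ltn_pmod i u_gt0; rewrite -(modnDml i k).
move: (i %% size u)%N im => m im; case: ltnP => h.
  by rewrite modn_small; [rewrite addnC | lia].
rewrite nth_take; last by lia.
have -> : (m + k = (m - (size u - k)) + size u)%N by lia.
by rewrite modnDr modn_small; last by lia.
Qed.

Lemma cyclic_letter_constant {A : eqType} (x0 : A) {u : seq A} :
  (forall i, cyclic_letter x0 u i.+1 = cyclic_letter x0 u i) -> constant u.
Proof.
move=> h; apply/(constantP x0); exists (cyclic_letter x0 u 0).
apply: (@eq_from_nth _ x0) => [|i iu]; first by rewrite size_nseq.
by rewrite nth_nseq iu -(cyclic_letter_lt x0 iu); elim: i {iu} => // i <-.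
Qed.

Lemma nth_word_power {A : Type} (x0 : A) (v : seq A) (k i : nat) :
  (i < k * size v)%N -> nth x0 (word_power v k) i = nth x0 v (i %% size v).
Proof.
rewrite /word_power; elim: k i => [|k IH] i; first by rewrite mul0n.
rewrite mulSn /= nth_cat => ikv; case: ltnP => h; first by rewrite modn_small.
rewrite IH; last by lia.
by rewrite -{2}(subnK h) modnDr.
Qed.

Lemma size_word_power {A : Type} (v : seq A) (k : nat) :
  size (word_power v k) = (k * size v)%N.
Proof. by rewrite /word_power size_flatten /shape map_nseq sumn_nseq mulnC. Qed.

(** Period 1 is excluded: it is the period of constant words, for which
    [proper_period_missing_letter] fails in length 2. *)
Definition proper_period {A : Type} (x0 : A) (u : seq A) (p : nat) : Prop :=
  [/\ (p %| size u)%N, (1 < p < size u)%N &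
      forall i, cyclic_letter x0 u (i + p) = cyclic_letter x0 u i].

(** A nonprimitive word is v^k with k >= 2 (k = 0 would make it empty, hence
    constant), and [size v] is the period; it exceeds 1 for lack of
    constancy. *)
Lemma nonprimitive_proper_period {A : eqType} (x0 : A) {u : seq A} :
  ~ primitive u -> ~~ constant u -> exists p, proper_period x0 u p.
Proof.
move=> /contrapT[v [k [vu uvk]]] nconst; exists (size v).
have su : size u = (k * size v)%N by rewrite uvk size_word_power.
have per i : cyclic_letter x0 u (i + size v) = cyclic_letter x0 u i.
  have [u0|u_gt0] := posnP (size u).
    by rewrite /cyclic_letter !nth_default // u0.
  have vdu : (size v %| size u)%N by rewrite su dvdn_mull.
  have nthu j : nth x0 u (j %% size u) = nth x0 v (j %% size v).
    rewrite {1}uvk nth_word_power ?modn_dvdm // -su; exact: ltn_pmod.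
  by rewrite /cyclic_letter !nthu modnDr.
have k1 : k <> 1%N by move=> k1; apply: vu; rewrite uvk k1 /word_power /= cats0.
have s0 : size u <> 0%N by move=> /size0nil u0; rewrite u0 in nconst.
have s1 : size v <> 1%N.
  move=> s1; case/negP: nconst; apply: (@cyclic_letter_constant _ x0) => i.
  by rewrite -addn1 -s1 per.
by split=> //; [rewrite su dvdn_mull | nia].
Qed.

Lemma proper_period_rot {A : Type} (x0 : A) {u : seq A} {p : nat} (k : nat) :
  (k <= size u)%N -> proper_period x0 u p -> proper_period x0 (rot k u) p.
Proof.
move=> ku [pu p1 per]; split; rewrite ?size_rot // => i.
by rewrite !cyclic_letter_rot // addnAC per.
Qed.

(** Position [L] is the last one or the last but one, so that the positions
    where the cyclic words may differ are among [L] and [L + 1].  The first case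
    makes a power determined by all its letters but one, the second forbids
    certain transitions between powers. *)
Lemma proper_period_missing_letter {A : Type} {x0 : A} {u v : seq A}
    {p q L : nat} :
  proper_period x0 u p -> proper_period x0 v q -> size u = size v ->
  (L.+2 = size u \/ L.+1 = size u) ->
  (forall i, (i < size u)%N -> i != L -> i != L.+1 ->
     nth x0 u i = nth x0 v i) ->
  nth x0 u L = nth x0 v L.
Proof.
move=> [pu p1 per_u] [qv q1 per_v] suv LN uv.
have LN' : (L < size u)%N by lia.
rewrite -!cyclic_letter_lt -?suv //.
apply: (agree_off_two pu _ p1 _ per_u per_v); rewrite ?suv // => i /andP[i1 iN].
rewrite /cyclic_letter -suv; have [h|h] := ltnP (L + i)%N (size u).
  by rewrite modn_small // uv //; lia.
rewrite -(subnK h) modnDr modn_small; last by lia.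
by apply: uv; lia.
Qed.

(** * Conjugacy classes and factors *)

Lemma conj_classP {A : finType} {m : nat} {u v : m.-tuple A} :
  reflect (exists2 k, (k <= m)%N & v = rot_tuple k u) (v \in conj_class u).
Proof.
rewrite inE; apply: (iffP (asboolP _)) => [[x [y [uxy vyx]]]|[k km ->]].
  exists (size x).
    by rewrite -(size_tuple u) uxy size_cat leq_addr.
  by apply: val_inj; rewrite /= uxy rot_size_cat.
by exists (take k u), (drop k u); rewrite cat_take_drop.
Qed.

Lemma conj_class_refl {A : finType} {m : nat} (u : m.-tuple A) :
  u \in conj_class u.
Proof.
by apply/conj_classP; exists 0%N => //; apply: val_inj; rewrite /= rot0.
Qed.

Lemma conj_class_eq {A : finType} {m : nat} {u v : m.-tuple A} :
  v \in conj_class u -> conj_class v = conj_class u.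
Proof.
have trans (x y z : m.-tuple A) :
    y \in conj_class x -> z \in conj_class y -> z \in conj_class x.
  move=> /conj_classP[k km ->] /conj_classP[l lm ->]; apply/conj_classP.
  pose j := (if (l + k <= m)%N then l + k else l + k - m)%N.
  exists j; first by rewrite /j; case: ifP; lia.
  by apply: val_inj; rewrite /= rot_add_mod size_tuple.
have sym (x y : m.-tuple A) : y \in conj_class x -> x \in conj_class y.
  move=> /conj_classP[k km ->]; apply/conj_classP; exists (m - k)%N.
    by rewrite leq_subr.
  apply: val_inj; rewrite /= -[LHS](rotK k) /rotr size_rot size_tuple //.
by move=> uv; apply/setP => z; apply/idP/idP; apply: trans => //; apply: sym.
Qed.

Lemma conj_class_rot {A : finType} {m : nat} {u v : m.+1.-tuple A} :
  v \in conj_class u -> rot_tuple 1 v \in conj_class u.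
Proof.
by move=> /conj_class_eq <-; apply/conj_classP; exists 1%N.
Qed.

Definition window {A : Type} (w : nat -> A) (i m : nat) : m.-tuple A :=
  [tuple w (i + j)%N | j < m].

Lemma nth_mktuple_lt {A : Type} (x0 : A) {m : nat} (f : nat -> A) {j : nat} :
  (j < m)%N -> nth x0 [tuple f i | i < m] j = f j.
Proof.
by move=> jm; rewrite (nth_mktuple (fun i : 'I_m => f i) x0 (Ordinal jm)).
Qed.

Lemma nth_window {A : Type} (x0 : A) (w : nat -> A) (i : nat) {m j : nat} :
  (j < m)%N -> nth x0 (window w i m) j = w (i + j)%N.
Proof. exact: (nth_mktuple_lt x0 (fun j => w (i + j)%N)). Qed.

Lemma FacP {A : finType} {w : nat -> A} {m : nat} {u : m.-tuple A} :
  reflect (exists i, u = window w i m) (u \in Fac w m).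
Proof.
have winE i : tval (window w i m) = [seq w j | j <- iota i m].
  apply: (@eq_from_nth _ (w 0%N)) => [|j].
    by rewrite size_tuple size_map size_iota.
  rewrite size_tuple => jm.
  by rewrite nth_window // (nth_map 0%N) ?size_iota // nth_iota.
rewrite inE; apply: (iffP (asboolP _)) => -[i ui]; exists i.
  by apply: val_inj; rewrite [LHS]ui size_tuple [RHS]winE.
by rewrite size_tuple ui winE.
Qed.

Definition init {A : Type} {m : nat} (u : m.+1.-tuple A) : m.-tuple A :=
  [tuple nth (thead u) u i | i < m].

Lemma nth_init {A : Type} (x0 : A) {m : nat} (u : m.+1.-tuple A) {j : nat} :
  (j < m)%N -> nth x0 (init u) j = nth x0 u j.
Proof.
move=> jm; rewrite (nth_mktuple_lt x0 (fun i => nth (thead u) u i)) //.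
by apply: set_nth_default; rewrite size_tuple; lia.
Qed.

Lemma eq_tuple_nth {A : Type} (x0 : A) {m : nat} (u v : m.-tuple A) :
  (forall i, (i < m)%N -> nth x0 u i = nth x0 v i) -> u = v.
Proof.
by move=> uv; apply/val_inj/(@eq_from_nth _ x0); rewrite !size_tuple.
Qed.

Lemma init_window {A : Type} (w : nat -> A) (i m : nat) :
  init (window w i m.+1) = window w i m.
Proof.
apply: (eq_tuple_nth (w 0%N)) => j jm.
by rewrite nth_init // !nth_window //; lia.
Qed.

Lemma behead_window {A : Type} (w : nat -> A) (i m : nat) :
  behead_tuple (window w i m.+1) = window w i.+1 m.
Proof.
apply: (eq_tuple_nth (w 0%N)) => j jm.
by rewrite /= nth_behead !nth_window // addSnnS.
Qed.

Lemma init_Fac {A : finType} {w : nat -> A} {m : nat} {u : m.+1.-tuple A} :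
  u \in Fac w m.+1 -> init u \in Fac w m.
Proof.
by move=> /FacP[i ->]; apply/FacP; exists i; rewrite init_window.
Qed.

Lemma behead_Fac {A : finType} {w : nat -> A} {m : nat} {u : m.+1.-tuple A} :
  u \in Fac w m.+1 -> behead_tuple u \in Fac w m.
Proof.
by move=> /FacP[i ->]; apply/FacP; exists i.+1; rewrite behead_window.
Qed.

Lemma nth_rot1 {A : Type} (x0 : A) {m : nat} (u : m.+1.-tuple A) {j : nat} :
  nth x0 (rot_tuple 1 u) j = if (j < m)%N then nth x0 u j.+1
                             else if j == m then nth x0 u 0 else x0.
Proof.
case/tupleP: u => a u; rewrite /= rot1_cons nth_rcons size_tuple.
by case: ltngtP.
Qed.

(** The suffix vertex of an edge is the prefix vertex of its rotation: this is
    what makes a class of length n a closed walk. *)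
Lemma behead_init_rot1 {A : Type} {m : nat} (u : m.+1.-tuple A) :
  behead_tuple u = init (rot_tuple 1 u).
Proof.
apply: (eq_tuple_nth (thead u)) => j jm.
by rewrite nth_init // nth_rot1 jm /= nth_behead.
Qed.

Lemma behead_init {A : Type} {m : nat} (u : m.+2.-tuple A) :
  behead_tuple (init u) = init (behead_tuple u).
Proof.
apply: (eq_tuple_nth (thead u)) => j jm.
by rewrite nth_init // /= !nth_behead nth_init.
Qed.

(** The walk that reads w meets every vertex, so a potential that is constant
    along edges is constant. *)
Lemma walk_const {A : finType} {w : nat -> A} {k : nat} {T : Type}
    {f : k.-tuple A -> T} :
  (forall e, e \in Fac w k.+1 -> f (init e) = f (behead_tuple e)) ->
  {in Fac w k &, forall u v, f u = f v}.
Proof.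
move=> fe _ _ /FacP[i ->] /FacP[j ->].
suff h l : f (window w l k) = f (window w 0 k) by rewrite (h i) (h j).
elim: l => // l <-; rewrite -(init_window w l) fe ?behead_window //.
by apply/FacP; exists l.
Qed.

(** * Classes of nonconstant powers *)

Definition power_classes {A : finType} (w : nat -> A) (m : nat) :
    {set {set m.-tuple A}} :=
  [set conj_class u | u : m.-tuple A & [&& conj_class u \subset Fac w m,
     ~~ `[< primitive u >] & ~~ constant u]].

(** A class is primitive, or a nonconstant power, or the class of some a^(m+1);
    in the last case [a] occurs in [w], hence the term [#|Alph w|]. *)
Lemma Lie_complexity_split {A : finType} (w : nat -> A) (m : nat) :
  (Lie_complexity w m.+1 <= primitive_Lie_complexity w m.+1
     + #|power_classes w m.+1| + #|Alph w|)%N.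
Proof.
pose consts := [set conj_class [tuple of nseq m.+1 a] | a in Alph w].
apply: leq_trans (leq_add (leqnn _) (leq_imset_card _ _ : #|consts| <= _)%N).
apply: leq_trans (leq_add (leq_card_setU _ _) (leqnn _)).
apply: leq_trans (leq_card_setU _ _); apply: subset_leq_card.
apply/subsetP => _ /imsetP[u uF ->]; rewrite inE in uF; rewrite !inE.
have [prim|nprim] := boolP `[< primitive u >].
  by rewrite (imset_f (@conj_class A m.+1)) // inE uF.
have [/(constantP (w 0%N))[a ua]|nconst] := boolP (constant u); last first.
  rewrite [X in _ || X || _](imset_f (@conj_class A m.+1)) ?orbT //.
  by rewrite inE uF nprim.
have {}ua : u = [tuple of nseq m.+1 a].
  by apply: val_inj; rewrite size_tuple in ua.
rewrite [X in _ || X](_ : _ = true) ?orbT // ua; apply: imset_f.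
have /FacP[i ui] := subsetP uF _ (conj_class_refl u).
rewrite inE; apply/asboolP; exists i.
have := nth_window (w 0%N) w i (ltn0Sn m).
by rewrite -ui ua /= addn0.
Qed.

Lemma power_classP {A : finType} {w : nat -> A} {m : nat} {T : {set m.-tuple A}}
    (x0 : A) :
  T \in power_classes w m ->
  exists u, [/\ T = conj_class u, T \subset Fac w m, ~~ constant u &
    exists p, {in T, forall y : m.-tuple A, proper_period x0 y p}].
Proof.
move=> /imsetP[u]; rewrite inE => /and3P[uF /asboolP nprim nconst] ->.
have [p up] := nonprimitive_proper_period x0 nprim nconst.
exists u; split=> //; exists p => _ /conj_classP[k km ->].
by apply: proper_period_rot; rewrite ?size_tuple.
Qed.

(** This makes the cycles of nonconstant powers edge-disjoint. *)
Lemma power_classes_init_inj {A : finType} {w : nat -> A} {m : nat}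
    {T T' : {set m.+1.-tuple A}} {y y' : m.+1.-tuple A} :
  T \in power_classes w m.+1 -> T' \in power_classes w m.+1 ->
  y \in T -> y' \in T' -> init y = init y' -> T = T'.
Proof.
move=> /(power_classP (w 0%N))[u [Tu _ _ [p Tp]]].
move=> /(power_classP (w 0%N))[v [Tv _ _ [q Tq]]] yT yT' iyy.
have agree i : (i < m)%N -> nth (w 0%N) y i = nth (w 0%N) y' i.
  by move=> im; rewrite -!nth_init // iyy.
suff yy : y = y'.
  rewrite Tu Tv; rewrite Tu in yT; rewrite Tv -yy in yT'.
  by rewrite -(conj_class_eq yT) -(conj_class_eq yT').
apply: (eq_tuple_nth (w 0%N)) => i; rewrite ltnS leq_eqVlt.
case/orP=> [/eqP->|]; last exact: agree.
apply: (proper_period_missing_letter (Tp _ yT) (Tq _ yT'));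
  rewrite ?size_tuple //.
  by right.
by move=> j jm jne _; apply: agree; lia.
Qed.

(** Let [y] run through [T] and suppose that rotating [init y] as a word of
    length m + 1 always gives the beginning of some power [y'].  Then [y'] and
    the rotation of [y] agree except possibly in their last two letters, hence
    also in the last but one, which says that the last letter of [y] equals its
    first.  Applied to all the rotations of [y], this makes [y] constant. *)
Lemma power_class_exit {A : finType} {w : nat -> A} {m : nat}
    {T : {set m.+2.-tuple A}} :
  T \in power_classes w m.+2 ->
  exists2 y, y \in T & forall T' y', T' \in power_classes w m.+2 ->
    y' \in T' -> init y' <> rot_tuple 1 (init y).
Proof.
move=> TP; apply: contrapT => noexit.
have [u [Tu _ /negP uconst [p Tp]]] := power_classP (w 0%N) TP.
have wrap y : y \in T -> nth (w 0%N) y m.+1 = nth (w 0%N) y 0.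
  move=> yT; apply: contrapT => yne; apply: noexit.
  exists y => // T' y' T'P yT' y'E; apply: yne.
  have [v [_ _ _ [q Tq]]] := power_classP (w 0%N) T'P.
  have ryT : rot_tuple 1 y \in T by move: yT; rewrite Tu; apply: conj_class_rot.
  have y'i i : (i < m.+1)%N ->
      nth (w 0%N) y' i = nth (w 0%N) (rot_tuple 1 (init y)) i.
    by move=> im; rewrite -y'E nth_init.
  have: nth (w 0%N) (rot_tuple 1 y) m = nth (w 0%N) y' m.
    apply: (proper_period_missing_letter (Tp _ ryT) (Tq _ yT')).
    - by rewrite !size_tuple.
    - by left; rewrite size_tuple.
    move=> i; rewrite size_tuple => im i1 i2; have im' : (i < m)%N by lia.
    rewrite y'i; last by lia.
    by rewrite !nth_rot1 im' ltnS (ltnW im') nth_init.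
  by rewrite y'i // !nth_rot1 ltnS leqnn ltnn eqxx nth_init.
apply: uconst; apply: (@cyclic_letter_constant _ (w 0%N)) => i.
have shift j : (j < m.+2)%N ->
    cyclic_letter (w 0%N) u (m.+1 + j) = cyclic_letter (w 0%N) u j.
  move=> jm; have := wrap (rot_tuple j u).
  rewrite -!(cyclic_letter_lt (w 0%N)) ?size_tuple //.
  rewrite !cyclic_letter_rot ?size_tuple ?(ltnW jm) //; apply.
  by rewrite Tu; apply/conj_classP; exists j; first exact: ltnW.
have := shift (i.+1 %% m.+2)%N (ltn_pmod _ (ltn0Sn _)).
rewrite /cyclic_letter size_tuple modn_mod modnDmr => <-.
by rewrite addnS -addSn modnDl.
Qed.

(** * Independence of the cycles *)

(** At a given edge at most one class of each kind contributes.  If the class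
    [T] of a power had a nonzero coefficient, take [y] given by
    [power_class_exit]: at the edge [init y] some class [U] of length k + 1 must
    compensate [T], and then at the rotated edge, still in [U], no power is
    available to compensate [U].  Once the powers have disappeared, the classes
    of length k + 1 are independent because they are disjoint. *)
Lemma cycle_independence {A : finType} {w : nat -> A} {k : nat}
    (W := [set conj_class u | u : k.+1.-tuple A
             & conj_class u \subset Fac w k.+1])
    (C := fun i : {U | U \in W} + {T | T \in power_classes w k.+2} =>
       match i with
       | inl U => traversals id (val U)
       | inr T => traversals init (val T)
       end)
    (x : {U | U \in W} + {T | T \in power_classes w k.+2} -> rat) :
  (forall e, e \in Fac w k.+1 -> \sum_i x i * C i e = 0) ->
  forall i, x i = 0.
Proof.
move=> rel.
have W_eq U e : U \in W -> e \in U -> U = conj_class e.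
  by move=> /imsetP[u _ ->] /conj_class_eq.
have W_sub U e : U \in W -> e \in U -> e \in Fac w k.+1.
  by move=> /imsetP[u]; rewrite inE => /subsetP + -> => /[apply].
have W_rot U e : U \in W -> e \in U -> rot_tuple 1 e \in U.
  by move=> /imsetP[u _ ->]; apply: conj_class_rot.
have left_sum (U : {U | U \in W}) e : e \in val U ->
    \sum_U' x (inl U') * C (inl U') e = x (inl U) * C (inl U) e.
  move=> eU; apply: big_only1 => // U' U'U _.
  apply/eqP; apply: contraNT U'U; rewrite mulf_eq0 negb_or.
  move=> /andP[_ /traversals_neq0P[z eU' /= ze]]; rewrite {}ze in eU'.
  by apply/eqP/val_inj; rewrite (W_eq _ _ (valP U') eU') (W_eq _ _ (valP U) eU).
have left_neq0 (U : {U | U \in W}) e : e \in val U -> C (inl U) e != 0.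
  by move=> eU; apply/traversals_neq0P; exists e.
have right0 T : x (inr T) = 0.
  apply/eqP/negP => /negP xT.
  have [y yT exit] := power_class_exit (valP T).
  have yF : init y \in Fac w k.+1.
    have [_ [_ /subsetP TF _ _]] := power_classP (w 0%N) (valP T).
    exact/init_Fac/TF.
  (* Only T contributes among powers, so some U contributes too. *)
  have := rel _ yF; rewrite big_sumType /=.
  rewrite [X in _ + X](big_only1 T) //; last first.
    move=> T' T'T _; apply/eqP; apply: contraNT T'T; rewrite mulf_eq0 negb_or.
    move=> /andP[_ /traversals_neq0P[y' y'T' yy']]; apply/eqP/val_inj.
    exact: power_classes_init_inj (valP T') (valP T) y'T' yT yy'.
  have [U /=|no] := pickP (fun U => x (inl U) * C (inl U) (init y) != 0);
    last first.
    rewrite big1 => [|U _]; last by apply/eqP; have := no U; move/negbFE.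
    move=> /eqP; rewrite add0r mulf_eq0 (negPf xT) /=; apply/negP.
    by apply/traversals_neq0P; exists y.
  rewrite mulf_eq0 negb_or => /andP[xU /traversals_neq0P[z eU /= ze]] _.
  rewrite {}ze in eU; have reU := W_rot _ _ (valP U) eU.
  have := rel _ (W_sub _ _ (valP U) reU).
  rewrite big_sumType /= (left_sum U) // [X in _ + X]big1 ?addr0.
    by move=> /eqP; rewrite mulf_eq0 (negPf xU) (negPf (left_neq0 _ _ reU)).
  move=> T' _; apply/eqP; rewrite mulf_eq0; apply/orP; right.
  by apply: contraT => /traversals_neq0P[y' y'T' /(exit _ _ (valP T') y'T')].
case=> // U; have [u _ Uu] := imsetP (valP U).
have uU : u \in val U by rewrite Uu conj_class_refl.
have := rel _ (W_sub _ _ (valP U) uU).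
rewrite big_sumType /= (left_sum U) // [X in _ + X]big1 => [|T _]; last first.
  by rewrite right0 mul0r.
by move=> /eqP; rewrite addr0 mulf_eq0 (negPf (left_neq0 _ _ uU)) orbF => /eqP.
Qed.

Theorem theorem3 (A : finType) (w : nat -> A) (n : nat) (n_gt0 : (0 < n)%N) :
  (Lie_complexity w n)%:Z + (Lie_complexity w n.+1)%:Z
    <= (factor_complexity w n)%:Z - (factor_complexity w n.-1)%:Z
       + 1 + #|Alph w|%:Z + (primitive_Lie_complexity w n.+1)%:Z.
Proof.
case: n n_gt0 => // k _.
have st_FV (e : k.+1.-tuple A) : e \in Fac w k.+1 ->
    init e \in Fac w k /\ behead_tuple e \in Fac w k.
  by move=> eF; split; [apply: init_Fac | apply: behead_Fac].
have := cycle_space_bound st_FV (@walk_const A w k rat) _ cycle_independence.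
rewrite card_sum !card_sig.
have -> : #|[pred T | T \in power_classes w k.+2]| = #|power_classes w k.+2|.
  exact: eq_card.
set W := [set conj_class u | u : k.+1.-tuple A & _].
have -> : #|[pred U | U \in W]| = Lie_complexity w k.+1 by exact: eq_card.
move=> bound; have := Lie_complexity_split w k.+1.
suff: (Lie_complexity w k.+1 + #|power_classes w k.+2| + factor_complexity w k
        <= factor_complexity w k.+1 + 1)%N by rewrite /=; lia.
apply: bound => -[U|T] v.
  have [u uF Uu] := imsetP (valP U); rewrite inE in uF.
  apply: (traversals_circulation (r := rot_tuple 1 (T := A))).
  - by move=> y z /(congr1 val) /rot_inj; apply: val_inj.
  - by rewrite Uu; move=> y; apply: conj_class_rot.
  - exact: behead_init_rot1.
  - by rewrite Uu; apply/subsetP.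
have [u [Tu TF _ _]] := power_classP (w 0%N) (valP T).
apply: (traversals_circulation (r := rot_tuple 1 (T := A))).
- by move=> y z /(congr1 val) /rot_inj; apply: val_inj.
- by rewrite Tu; move=> y; apply: conj_class_rot.
- by move=> y; rewrite behead_init behead_init_rot1.
- by move=> y yT; apply/init_Fac/(subsetP TF).
Qed.
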